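(* For $|q|<1$, $$\sum_{n\ge 1}\mathit{pa}(n)q^n=\frac{3-\sqrt{5}}{2}\left(\prod_{k\ge 1}\frac{1+q^k-q^{2k}}{1-q^{2k}}\right)\left(1+\frac{3+\sqrt{5}}{2}\sum_{n\ge 1}\frac{\left(\frac{\sqrt{5}-1}{2}\right)^n}{1+\frac{\sqrt{5}+1}{2}q^n}\right)-2.$$
   Context: A partition of a positive integer $n$ is a weakly decreasing sequence of positive integers with sum $n$. An unlimited parity alternating partition is a partition whose different parts alternate in parity: if the distinct part sizes are $d_1>d_2>\cdots>d_r$, then $d_i$ and $d_{i+1}$ have different parities for every $i$ (parts may be repeated). $\mathit{pa}(n)$ is the number of such partitions of $n$.
   Formalization: At points with |q|<1 where some denominator 1+((√5+1)/2)q^n vanishes (e.g. q=-(√5-1)/2) the right-hand side is undefined; there it is read as its limit as z→q, z≠q, and elsewhere the identity is proved pointwise. *)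

(* Defs.v *)
From mathcomp Require Import all_boot all_order all_algebra.
From mathcomp Require Import complex.
From mathcomp Require Import all_classical all_reals.
From mathcomp Require Import topology normedtype sequences.

Set Implicit Arguments.
Unset Strict Implicit.
Unset Printing Implicit Defensive.

Import Order.TTheory GRing.Theory Num.Theory.
Import numFieldNormedType.Exports.

Local Open Scope ring_scope.
Local Open Scope complex_scope.

Definition is_partition (n : nat) (s : seq nat) : bool :=
  [&& sorted geq s, all (leq 1) s & sumn s == n].

(* On a weakly decreasing [s], [undup s] is the list d_1 > ... > d_r of the
   distinct part sizes. *)
Definition parity_alternating (s : seq nat) : bool :=
  sorted (fun a b => odd a != odd b) (undup s).

(* A partition of [n] has at most [n] parts, each at most [n], so it is a
   bounded sequence over ['I_n.+1]; see [partition_bseq]. *)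
Definition pa (n : nat) : nat :=
  #|[set s : n.-bseq 'I_n.+1 |
      let parts := [seq val i | i <- s] in
      is_partition n parts && parity_alternating parts]|.

Lemma partition_bseq (n : nat) (s : seq nat) :
  is_partition n s -> exists t : n.-bseq 'I_n.+1, [seq val i | i <- t] = s.
Proof.
case/and3P=> _ s_gt0 /eqP s_sum.
have size_s : (size s <= n)%N.
  rewrite -s_sum; elim: s s_gt0 {s_sum} => //= a s IHs /andP[a_gt0 /IHs le_s].
  by rewrite -add1n leq_add.
have le_part : {in s, forall a, (a < n.+1)%N}.
  move=> a; rewrite ltnS -s_sum; elim: s {s_gt0 s_sum size_s} => //= b s IHs.
  by rewrite inE => /orP[/eqP->|/IHs le_a];
    rewrite ?leq_addr // ?(leq_trans le_a) ?leq_addl.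
have size_t : (size [seq (inord a : 'I_n.+1) | a <- s] <= n)%N by rewrite size_map.
exists (Bseq size_t); rewrite /= -map_comp; apply: map_id_in => a /le_part.
exact: inordK.
Qed.

Local Open Scope classical_set_scope.

(* The complex numbers over [R], packaged as a [numClosedFieldType] so that they
   get the topology induced by the modulus, which is not declared on the bare
   type [R[i]]. *)
Definition Cplx (R : realType) : numClosedFieldType := R[i].

Section Series.
Variable C : numClosedFieldType.
Implicit Types (u : nat -> C) (q : C).

(* The sequences u_1 + ... + u_N and u_1 * ... * u_N, whose limits are
   the series and infinite product indexed by n >= 1. *)
Definition psum u : nat -> C := fun N => \sum_(1 <= n < N.+1) u n.
Definition pprod u : nat -> C := fun N => \prod_(1 <= n < N.+1) u n.

Definition sqrt5 : C := sqrtC 5.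

Definition pa_term q (n : nat) : C := (pa n)%:R * q ^+ n.

Definition prod_factor q (k : nat) : C :=
  (1 + q ^+ k - q ^+ (2 * k)) / (1 - q ^+ (2 * k)).

(* This vanishes at isolated points of the unit disc (q ^+ n = (1 - sqrt5) / 2),
   where a factor of the product vanishes too; there [rhs q] is a junk value and
   the right-hand side is only defined as the limit of [rhs] at [q]. *)
Definition sum_denom q (n : nat) : C := 1 + (sqrt5 + 1) / 2 * q ^+ n.

Definition sum_term q (n : nat) : C :=
  ((sqrt5 - 1) / 2) ^+ n / sum_denom q n.

Definition pa_gf q : C := limn (psum (pa_term q)).

Definition rhs q : C :=
  (3 - sqrt5) / 2 * limn (pprod (prod_factor q)) *
  (1 + (3 + sqrt5) / 2 * limn (psum (sum_term q))) - 2.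

End Series.

(* Main.v *)
Require Import Defs.
From mathcomp Require Import all_boot all_order all_algebra.
From mathcomp Require Import complex.
From mathcomp Require Import all_classical all_reals.
From mathcomp Require Import topology normedtype sequences exp.
From mathcomp Require Import ring lra zify.
Import Order.TTheory GRing.Theory Num.Theory.
Import numFieldNormedType.Exports.

(* Classify parity alternating partitions by their number [k] of parts.
   Subtracting 1 from every part flips all parities, and shows that those with
   [k] parts have generating function q^k/(1-q^k) P_(k-1), where P_k is the
   [k]-th partial product.  Let f be the golden ratio and a = 1/f.  As
   1+x-x^2 = (1+fx)(1-ax), the sum over [k] is, up to a factor and a constant,
   the basic hypergeometric series L(b) = 2phi1(a,b;ab;q,q) at b = -f.  The
   contiguous relation
     (1-ab) L(b) - a (1-b) L(bq) = (a)_oo (bq)_oo / ((abq)_oo (q)_oo)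
   holds because its left-hand side telescopes; iterating b -> bq, which
   converges since 0 < a < 1, expands L(-f) as an infinite product times the sum
   of a^m / (1 + f q^m).  At the points where some 1 + f q^n vanishes one
   concludes by continuity, these zeros being isolated. *)

(** * Counting by number of parts *)

Section Counting.
Local Open Scope nat_scope.

(** A relation between neighbours, with [a == b] allowing repeated parts; unlike [undup], it passes
    directly through [map] and [++]. *)
Definition pa_rel (a b : nat) : bool :=
  (b <= a) && ((a == b) || (odd a != odd b)).

(** Equal entries of a weakly decreasing list are adjacent: [undup] preserves the head of the tail
    [b :: s], and [a] occurs in that tail exactly when [a == b]. *)
Lemma parity_alternatingE (s : seq nat) :
  sorted geq s && parity_alternating s = sorted pa_rel s.
Proof.
have tr : transitive geq by move=> x y z xy yz; apply: leq_trans yz xy.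
have head_undup b t : path geq b t -> exists u, undup (b :: t) = b :: u.
  elim: t b => [|c t IHt] b /=; first by exists [::].
  case/andP=> cb pt; case: ifP => [|_]; last by eexists.
  have [u ut] := IHt _ pt; move=> bt; exists u; rewrite -[RHS]/(b :: u).
  suff -> : b = c by [].
  apply/eqP; rewrite eqn_leq cb andbT.
  by case/predU1P: bt => [->//|]; exact: (allP (order_path_min tr pt)).
elim: s => [//|a [//|b s] IHs].
rewrite -[RHS]/(pa_rel a b && sorted pa_rel (b :: s)) -IHs.
rewrite -[sorted geq (a :: _)]/((b <= a) && sorted geq (b :: s)) /pa_rel.
case ba: (b <= a) => //=; case ps: (path geq b s); last by rewrite andbF.
have [u uE] := head_undup _ _ ps.
rewrite /parity_alternating -[undup (a :: _)]/(if a \in b :: s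
  then undup (b :: s) else a :: undup (b :: s)) uE.
have -> : (a \in b :: s) = (a == b).
  apply/idP/eqP => [|->]; last by rewrite inE eqxx.
  case/predU1P => [//|/(allP (order_path_min tr ps)) ab].
  by apply/eqP; rewrite eqn_leq ba andbT.
by case: eqP.
Qed.

Definition pa_partition (n : nat) (s : seq nat) : bool :=
  [&& sorted pa_rel s, all (leq 1) s & sumn s == n].

Lemma is_partition_pa (n : nat) (s : seq nat) :
  is_partition n s && parity_alternating s = pa_partition n s.
Proof.
rewrite /is_partition /pa_partition -parity_alternatingE.
by case: sorted; rewrite //= andbC.
Qed.

Definition pa_count (P : pred (seq nat)) (n : nat) : nat :=
  #|[set s : n.-bseq 'I_n.+1 |
      let parts := [seq val i | i <- s] in pa_partition n parts && P parts]|.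

Lemma pa_countT (n : nat) : pa n = pa_count predT n.
Proof.
by apply: eq_card => s; rewrite !inE /= andbT is_partition_pa.
Qed.

Lemma eq_pa_count (P Q : pred (seq nat)) (n : nat) :
  (forall s, pa_partition n s -> P s = Q s) -> pa_count P n = pa_count Q n.
Proof.
move=> PQ; apply: eq_card => s; rewrite !inE /=.
by case: (boolP (pa_partition _ _)) => //= /PQ.
Qed.

Lemma pa_countU (P Q : pred (seq nat)) (n : nat) :
  (forall s, P s -> ~~ Q s) ->
  pa_count (fun s => P s || Q s) n = pa_count P n + pa_count Q n.
Proof.
move=> PQ; rewrite /pa_count -cardsUI.
rewrite [X in _ = _ + #|pred_of_set X|](_ : _ = finset.set0) ?cards0 ?addn0.
  by apply: eq_card => s; rewrite !inE /= andb_orr.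
apply/setP => s; rewrite !inE /=; apply/negP => /andP[/andP[_ /PQ Qs] /andP[_]].
exact/negP.
Qed.

Lemma pa_count0 (P : pred (seq nat)) (n : nat) :
  (forall s, pa_partition n s -> ~~ P s) -> pa_count P n = 0.
Proof.
move=> P0; apply/eqP; rewrite cards_eq0; apply/eqP/setP => s; rewrite !inE /=.
by apply/negP => /andP[/P0 /negP].
Qed.

Lemma leq_pa_count (P : pred (seq nat)) (n : nat) : pa_count P n <= pa n.
Proof.
rewrite pa_countT; apply: subset_leq_card; apply/fintype.subsetP => s.
by rewrite !inE /= andbT => /andP[].
Qed.

(** The type of bounded sequences depends on [n]; as plain [seq nat], partitions of different
    numbers can be compared. *)
Definition pa_enum (P : pred (seq nat)) (n : nat) : seq (seq nat) :=
  [seq [seq val i | i <- bseqval s] | s in [set s : n.-bseq 'I_n.+1 |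
      let parts := [seq val i | i <- s] in pa_partition n parts && P parts]].

Lemma mem_pa_enum (P : pred (seq nat)) (n : nat) (s : seq nat) :
  (s \in pa_enum P n) = pa_partition n s && P s.
Proof.
apply/fintype.imageP/idP => [[t]|H]; first by rewrite inE /= => H ->.
have /andP[/(@partition_bseq n s)[t ts] _] : is_partition n s && parity_alternating s.
  by rewrite is_partition_pa; case/andP: H.
by exists t; rewrite ?inE /= ts.
Qed.

Lemma pa_enum_uniq (P : pred (seq nat)) (n : nat) : uniq (pa_enum P n).
Proof.
rewrite map_inj_uniq ?enum_uniq // => s t /(inj_map val_inj) st.
exact: val_inj.
Qed.

(** The image under [f] of the first list and the second list are duplicate free with the same
    members, hence permutations of each other. *)
Lemma pa_count_bij (f : seq nat -> seq nat) (P Q : pred (seq nat)) (n m : nat) :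
  (forall s, pa_partition n s -> P s -> pa_partition m (f s) && Q (f s)) ->
  (forall s t, pa_partition n s -> P s -> pa_partition n t -> P t ->
     f s = f t -> s = t) ->
  (forall t, pa_partition m t -> Q t ->
     exists2 s, pa_partition n s && P s & f s = t) ->
  pa_count P n = pa_count Q m.
Proof.
move=> fP finj fsurj.
have sz P' n' : pa_count P' n' = size (pa_enum P' n') by rewrite size_image.
rewrite !sz -(size_map f); apply/perm_size/uniq_perm.
- rewrite map_inj_in_uniq ?pa_enum_uniq // => s t.
  by rewrite !mem_pa_enum => /andP[? ?] /andP[? ?]; apply: finj.
- exact: pa_enum_uniq.
move=> t; rewrite mem_pa_enum; apply/mapP/andP => [[s]|[/fsurj H /H[s ps <-]]].
  by rewrite mem_pa_enum => /andP[s1 s2 ->]; apply/andP/fP.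
by exists s; rewrite ?mem_pa_enum.
Qed.

(* Since [last 1 [::] = 1], the empty partition counts as having an odd smallest
   part. *)
Definition pa_le_odd (k : nat) : nat -> nat :=
  pa_count (fun s => (size s <= k) && odd (last 1 s)).
Definition pa_eq_odd (k : nat) : nat -> nat :=
  pa_count (fun s => (size s == k) && odd (last 1 s)).
Definition pa_eq_even (k : nat) : nat -> nat :=
  pa_count (fun s => (size s == k) && ~~ odd (last 1 s)).

Lemma pa_le_oddS (k n : nat) :
  pa_le_odd k.+1 n = pa_le_odd k n + pa_eq_odd k.+1 n.
Proof.
rewrite -pa_countU.
  by apply: eq_pa_count => s _; rewrite -andb_orl; congr (_ && _); lia.
by move=> s /andP[ks _]; rewrite negb_and; lia.
Qed.

Lemma pa_partition_nil (n : nat) : pa_partition n [::] = (n == 0).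
Proof. by rewrite /pa_partition /= eq_sym. Qed.

Lemma pa_le_odd0 (n : nat) : pa_le_odd 0 n = (n == 0).
Proof.
case: n => [|n]; last first.
  by apply: pa_count0 => -[|a s]; rewrite ?pa_partition_nil.
have sz : pa_le_odd 0 0 = size (pa_enum (fun s => (size s <= 0) && odd (last 1 s)) 0).
  by rewrite size_image.
rewrite sz -[RHS]/(size [:: [::] : seq nat]); apply/perm_size/uniq_perm => //.
  exact: pa_enum_uniq.
move=> s; rewrite mem_pa_enum inE; by case: s => [|a s] //=; rewrite andbF.
Qed.

Lemma size_pa_partition (n : nat) (s : seq nat) : pa_partition n s -> size s <= n.
Proof.
case/and3P=> _ s1 /eqP <-; elim: s s1 => //= a s IHs /andP[a1 /IHs]; lia.
Qed.

Lemma pa_eq_odd_small (k n : nat) : n < k -> pa_eq_odd k n = 0.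
Proof.
move=> nk; apply: pa_count0 => s /size_pa_partition; rewrite negb_and; lia.
Qed.

Lemma pa_eq_even_small (k n : nat) : n < k -> pa_eq_even k n = 0.
Proof.
move=> nk; apply: pa_count0 => s /size_pa_partition; rewrite negb_and; lia.
Qed.

Lemma sorted_pa_rel_succ (s : seq nat) :
  sorted pa_rel (map succn s) = sorted pa_rel s.
Proof.
case: s => //= a s; rewrite path_map; apply: eq_path => x y.
by rewrite /pa_rel /= ltnS eqSS; case: (odd x) (odd y) => [] [].
Qed.

Lemma sumn_succ (s : seq nat) : sumn (map succn s) = sumn s + size s.
Proof. by elim: s => //= a s ->; lia. Qed.

Lemma last_succ (a : nat) (s : seq nat) :
  0 < size s -> last a (map succn s) = (last a s).+1.
Proof. by case: s => //= b s _; rewrite last_map. Qed.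

Lemma last_gt0 (s : seq nat) : all (leq 1) s -> 0 < last 1 s.
Proof. by case: s => // a s /allP; apply; exact: mem_last. Qed.

Lemma sorted_pa_rel_geq (s : seq nat) : sorted pa_rel s -> sorted geq s.
Proof. by apply: sub_sorted => x y /andP[]. Qed.

Lemma last_le_sorted (d x : nat) (s : seq nat) :
  sorted pa_rel s -> x \in s -> last d s <= x.
Proof.
elim: s x => [//|a [|b s] IHs] x; first by move=> _; rewrite inE => /eqP->.
rewrite -[sorted _ _]/(pa_rel a b && sorted pa_rel (b :: s)) => /andP[/andP[ba _] bs].
rewrite inE -[last d _]/(last d (b :: s)) => /predU1P[->|]; last exact: IHs.
by apply: leq_trans ba; apply: IHs; rewrite ?mem_head.
Qed.

Lemma succ_pred_parts (s : seq nat) :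
  all (leq 1) s -> map succn (map predn s) = s.
Proof.
by move=> /allP s1; rewrite -map_comp; apply: map_id_in => x /s1; case: x.
Qed.

(** Add 1 to each of the [k] parts. This is onto because an even smallest part is at least 2, so
    subtracting 1 leaves positive parts. For [k = 0] the empty sequence would be counted on the
    right only. *)
Lemma pa_eq_evenD (k n : nat) : 0 < k -> pa_eq_even k (n + k) = pa_eq_odd k n.
Proof.
move=> k0; apply/esym; apply: (pa_count_bij (map succn)).
- move=> s /and3P[s1 s2 /eqP s3] /andP[/eqP s4 s5].
  rewrite /pa_partition sorted_pa_rel_succ s1 sumn_succ s3 s4 size_map s4 !eqxx.
  rewrite all_map last_succ ?s4 //= s5 andbT /=; apply/andP; split=> //.
  by apply/allP.
- by move=> s t _ _ _ _ /(inj_map succn_inj).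
- move=> t /and3P[s1 s2 /eqP s3] /andP[/eqP s4 s5].
  have tE := succ_pred_parts _ s2.
  exists (map predn t) => //.
  have sz : size (map predn t) = k by rewrite size_map.
  have t2 x : x \in t -> 1 < x.
    move=> /(last_le_sorted 1 _ _ s1); apply: leq_trans.
    by have := last_gt0 _ s2; case: (last 1 t) s5 => [|[|]].
  move: s1 s3 s5; rewrite /pa_partition -{1 2 3}tE sorted_pa_rel_succ sumn_succ sz.
  rewrite last_succ ?sz //= => -> /eqP; rewrite eqn_add2r => -> /negPn ->.
  rewrite eqxx !andbT all_map; apply/allP => x /t2 /=; lia.
Qed.

(** Undoes subtracting 1 from each of [k] parts and dropping the zeros: the lost parts come back as
    trailing 1s. *)
Definition succ_parts (k : nat) (s : seq nat) : seq nat :=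
  map succn s ++ nseq (k - size s) 1.

Lemma sorted_cat_nseq1 (s : seq nat) (j : nat) :
  sorted pa_rel (s ++ nseq j 1) =
  sorted pa_rel s && ((0 < j) && (0 < size s) ==> pa_rel (last 1 s) 1).
Proof.
have p1 i : path pa_rel 1 (nseq i 1) by elim: i => //= i ->.
case: s => [|a s]; first by case: j => [|j] //=; rewrite ?p1 ?andbF.
case: j => [|j]; first by rewrite cats0 andbT.
by rewrite /= cat_path /= p1 andbT.
Qed.

(** Subtract 1 from every part. If no part is 1, all [k.+1] parts survive and the smallest becomes
    even. Otherwise at most [k] survive; the smallest survivor, if any, is odd, because the part
    size just above 1 was even. *)
Lemma pa_eq_oddD (k n : nat) :
  pa_eq_odd k.+1 (n + k.+1) = pa_eq_even k.+1 n + pa_le_odd k n.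
Proof.
rewrite -pa_countU; last by move=> s /andP[/eqP -> _]; rewrite negb_and ltnn.
apply/esym; apply: (pa_count_bij (succ_parts k.+1)).
- move=> s /and3P[s1 s2 /eqP s3] H.
  have sk : size s <= k.+1 by case/orP: H => /andP[]; lia.
  rewrite /pa_partition sorted_cat_nseq1 sorted_pa_rel_succ s1 /=.
  rewrite all_cat all_map all_nseq orbT andbT sumn_cat sumn_succ s3.
  rewrite sumn_nseq mul1n -addnA subnKC // eqxx size_cat size_map size_nseq subnKC //.
  rewrite eqxx last_cat /= !andbT -!andbA; apply/and3P; split.
  + apply/implyP; rewrite subn_gt0 => /andP[sk' s0].
    rewrite last_succ // /pa_rel /=.
    by case/orP: H => /andP[/eqP]; [lia|move=> _ ->; rewrite orbT].
  + by apply/allP.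
  + case/orP: H => /andP[]; first by move=> /eqP s4 s5; rewrite s4 subnn /= last_succ ?s4.
    by move=> s4 _; rewrite subSn //=; elim: (k - size s).
- move=> s t /and3P[_ s1 _] _ /and3P[_ t1 _] _ st.
  (* Discarding the 1s and subtracting 1 inverts [succ_parts] on positive sequences, which gives
     injectivity. *)
  have E u : all (leq 1) u -> [seq x.-1 | x <- succ_parts k.+1 u & 1 < x] = u.
    move=> /allP u1; rewrite filter_cat map_cat [X in _ ++ X](_ : _ = [::]).
      rewrite cats0 filter_map -map_comp map_id_in //.
      rewrite (all_filterP _) //; exact/allP.
    by elim: (k.+1 - size u).
  by rewrite -(E _ s1) -(E _ t1) st.
- move=> t /and3P[s1 s2 /eqP s3] /andP[/eqP s4 s5].
  pose u := [seq x <- t | 1 < x]; pose s := map predn u.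
  (* Since [t] is weakly decreasing, its parts equal to 1 all stand at the end. *)
  have tE : t = u ++ nseq (k.+1 - size u) 1.
    rewrite {}/s {}/u -{}s4 {s3 s5}; elim: t s1 s2 => [//|a t IHt] pt /= /andP[a1 t1].
    case: ifP => a2 /=; first by rewrite subSS -IHt ?(path_sorted pt).
    have {a1 a2}aE : a = 1 by lia.
    subst a; have t1' x : x \in t -> x = 1.
      have tr : transitive geq by move=> x' y z xy yz; apply: leq_trans yz xy.
      move=> xt; have := allP (order_path_min tr (sorted_pa_rel_geq (1 :: t) pt)) _ xt.
      by have := allP t1 _ xt; rewrite /geq /=; lia.
    have -> : [seq x <- t | 1 < x] = [::].
      by apply/eqP; rewrite -size_eq0 size_filter -leqn0 leqNgt -has_count;
        apply/hasPn => x /t1' ->.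
    by rewrite subn0 /=; congr (_ :: _); apply/all_pred1P/allP => x /t1' /= ->.
  have u2 : all (leq 2) u by exact: filter_all.
  have uE : map succn s = u.
    by apply: succ_pred_parts; apply: sub_all u2 => x /ltnW.
  have us : size u = size s by rewrite size_map.
  have fs : succ_parts k.+1 s = t by rewrite /succ_parts uE -us -tE.
  have sk : size s <= k.+1.
    by rewrite -us size_filter -s4 count_size.
  exists s => //.
  move: s1 s3 s5; rewrite -fs sorted_cat_nseq1 sorted_pa_rel_succ => /andP[s1 H].
  rewrite sumn_cat sumn_succ sumn_nseq mul1n -addnA subnKC // => /eqP.
  rewrite eqn_add2r => ns.
  rewrite /pa_partition s1 ns andbT /= => lt.
  rewrite all_map (sub_all _ u2); last by case=> [|[]].
  rewrite /=; move: H lt; rewrite size_map subn_gt0 /succ_parts last_cat.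
  (* Distinguishes whether [t] contains a 1. If it does and [s] is nonempty, [pa_rel] at the
     junction makes the part before the 1s even, so the smallest part of [s] is odd. *)
  case: (ltngtP (size s) k.+1) sk => // sk _; last first.
    by rewrite sk subnn /= last_succ ?sk //= => _ ->; rewrite ltnn.
  rewrite ltnS in sk; rewrite sk /=; case: (posnP (size s)) => s0.
    by case: (s) s0 => // _ _ _; rewrite orbT.
  rewrite last_succ // /pa_rel /=; case/orP.
    have : 0 < last 1 s.
      by apply: last_gt0; rewrite all_map (sub_all _ u2) //; case=> [|[]].
    lia.
  by case: odd => //; rewrite orbT.
Qed.

(** For [0 < n] the empty partition does not occur, so the sum may start at [k = 1]. *)
Lemma sum_pa_eq (n N : nat) : 0 < n ->
  \sum_(1 <= k < N.+1) (pa_eq_odd k n + pa_eq_even k n) =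
  pa_count (fun s => size s <= N) n.
Proof.
move=> n0; elim: N => [|N IHN].
  rewrite big_geq // pa_count0 // => -[|//].
  by rewrite pa_partition_nil; case: n n0.
rewrite big_nat_recr //= IHN -pa_countU; last first.
  by move=> s /andP[_ ->]; rewrite andbF.
rewrite -pa_countU.
  apply: eq_pa_count => s _; case: odd; rewrite /= ?andbT ?andbF ?orbF; lia.
move=> s; case: odd; rewrite /= ?andbT ?andbF ?orbF; lia.
Qed.

Lemma sum_pa_eq_le (n N : nat) : 0 < n ->
  \sum_(1 <= k < N.+1) (pa_eq_odd k n + pa_eq_even k n) <= pa n.
Proof. by move=> n0; rewrite sum_pa_eq // leq_pa_count. Qed.

Lemma pa_sum (n N : nat) : 0 < n -> n <= N ->
  pa n = \sum_(1 <= k < N.+1) (pa_eq_odd k n + pa_eq_even k n).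
Proof.
move=> n0 nN; rewrite sum_pa_eq // pa_countT; apply: eq_pa_count => s.
by move/size_pa_partition => sn; rewrite /= (leq_trans sn nN).
Qed.

End Counting.

Local Open Scope ring_scope.
Local Open Scope classical_set_scope.

(** * The modulus and convergence in [Cplx R] *)

(* The norm of [Cplx R] takes its values in [Cplx R]; [cabs] is its real part. *)
Definition cabs {R : realType} (z : Cplx R) : R := complex.Re (`|z| : R[i]).

Section ComplexModulus.
Variable R : realType.
Implicit Types (x y z : Cplx R) (r K : R).

Lemma cabsE z : `|z| = (cabs z)%:C%C :> R[i].
Proof. by rewrite /cabs normc_def. Qed.

Lemma real_complex_inj r r' : r%:C%C = r'%:C%C :> R[i] -> r = r'.
Proof. by case. Qed.

Lemma cabs_ge0 z : 0 <= cabs z.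
Proof. by rewrite -lecR -cabsE; exact: (@normr_ge0 (Cplx R) (Cplx R)). Qed.

Lemma cabs0 : cabs (0 : Cplx R) = 0.
Proof. by rewrite /cabs normr0. Qed.

Lemma cabs1 : cabs (1 : Cplx R) = 1.
Proof. by rewrite /cabs normr1. Qed.

Lemma cabsM x y : cabs (x * y) = cabs x * cabs y.
Proof. by apply: real_complex_inj; rewrite rmorphM -!cabsE; exact: normrM. Qed.

Lemma cabsX x n : cabs (x ^+ n) = cabs x ^+ n.
Proof. by apply: real_complex_inj; rewrite rmorphXn -!cabsE; exact: normrX. Qed.

Lemma cabsV x : cabs x^-1 = (cabs x)^-1.
Proof.
have [->|x0] := eqVneq x 0; first by rewrite invr0 cabs0 invr0.
have : cabs x * cabs x^-1 = 1 by rewrite -cabsM divff // cabs1.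
have [->|c0] := eqVneq (cabs x) 0.
  by rewrite mul0r => /eqP; rewrite eq_sym oner_eq0.
by move=> E; apply: (mulfI c0); rewrite E divff.
Qed.

Lemma cabsN x : cabs (- x) = cabs x.
Proof. by rewrite /cabs normrN. Qed.

Lemma cabsB x y : cabs (x - y) = cabs (y - x).
Proof. by rewrite -cabsN opprB. Qed.

Lemma ler_cabsD x y : cabs (x + y) <= cabs x + cabs y.
Proof. by rewrite -lecR rmorphD -!cabsE; exact: (@ler_normD (Cplx R) (Cplx R)). Qed.

Lemma ler_cabs_sub x y : cabs x - cabs y <= cabs (x - y).
Proof. by rewrite lerBlDr; apply: le_trans (ler_cabsD _ _); rewrite subrK. Qed.

Lemma ler_cabs_sum (I : Type) (s : seq I) (P : pred I) (F : I -> Cplx R) :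
  cabs (\sum_(i <- s | P i) F i) <= \sum_(i <- s | P i) cabs (F i).
Proof.
elim/big_ind2: _ => [|a b c d ab cd|//]; first by rewrite cabs0.
by apply: le_trans (ler_cabsD _ _) _; exact: lerD.
Qed.

Lemma cabs_nat n : cabs (n%:R : Cplx R) = n%:R.
Proof. by apply: real_complex_inj; rewrite -cabsE rmorph_nat; exact: normr_nat. Qed.

Lemma cabs_gt0 x : (0 < cabs x) = (x != 0).
Proof.
rewrite lt_neqAle cabs_ge0 andbT eq_sym; congr negb; apply/eqP/eqP => [c0|->].
  by apply/eqP; rewrite -normr_eq0; apply/eqP; rewrite cabsE c0.
by rewrite cabs0.
Qed.

Lemma normr_lt_cabs x r : (`|x| < (r%:C%C : Cplx R)) = (cabs x < r).
Proof. by rewrite -ltcR -cabsE. Qed.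

(** A positive element of [Cplx R] is a positive real number, so real radii suffice. *)
Lemma cplx_cvgP (T : Type) (F : set_system T) (FF : Filter F) (u : T -> Cplx R)
    (l : Cplx R) :
  (forall e : R, 0 < e -> \forall t \near F, cabs (l - u t) < e) <->
  u @ F --> l.
Proof.
split=> [H|/cvgrPdist_lt H e e0].
  apply/cvgrPdist_lt => e e0.
  have eE : e = (complex.Re (e : R[i]))%:C%C :> R[i].
    by move: e0; case: e => a b; rewrite ltcE /= => /andP[/eqP ->].
  have : 0 < complex.Re (e : R[i]) by rewrite -ltcR -eE.
  move/H; apply: filterS => t; rewrite {2}eE; by rewrite normr_lt_cabs.
have : 0 < (e%:C%C : Cplx R) by move: e0; rewrite -ltcR.
move/H; apply: filterS => t; by rewrite normr_lt_cabs.
Qed.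

Lemma cplx_cvg_squeeze (u : nat -> Cplx R) (v : nat -> R) (l : Cplx R) :
  (forall n, cabs (l - u n) <= v n) -> v @ \oo --> 0 -> u @ \oo --> l.
Proof.
move=> uv /cvgrPdist_lt v0; apply/cplx_cvgP => e /v0.
apply: filterS => n; rewrite sub0r normrN; apply: le_lt_trans.
exact: le_trans (uv n) (ler_norm _).
Qed.

Lemma cabs_cvg_le (u : nat -> Cplx R) (l x : Cplx R) K :
  u @ \oo --> l -> (\forall n \near \oo, cabs (u n - x) <= K) -> cabs (l - x) <= K.
Proof.
move=> /cplx_cvgP ul uK; apply/ler_addgt0Pr => e /ul le.
have [n [n1 n2]] := filter_ex (filterI le uK).
have -> : l - x = (l - u n) + (u n - x) by rewrite addrA subrK.
by apply: le_trans (ler_cabsD _ _) _; rewrite addrC; apply: lerD => //; exact: ltW.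
Qed.

Lemma cvg_geo K r : 0 <= r < 1 -> (fun n => K * r ^+ n) @ \oo --> 0.
Proof.
move=> /andP[r0 r1].
by apply: (@cvg_geometric R K r); rewrite ger0_norm.
Qed.

Lemma sum_geo_le r n : 0 <= r < 1 -> \sum_(0 <= i < n) r ^+ i <= (1 - r)^-1.
Proof.
move=> /andP[r0 r1]; have r1' : 0 < 1 - r by lra.
rewrite -(ler_pM2l r1') divff ?gt_eqF // big_mkord -[X in X - r](expr1n _ n).
rewrite [X in X * _](_ : _ = 1 - r) ?expr1n //.
rewrite -[1 - r]opprB mulNr -subrX1 opprB.
by rewrite lerBlDr lerDl exprn_ge0.
Qed.

Lemma sum_geo_from_le r m n : 0 <= r < 1 ->
  \sum_(m <= i < n) r ^+ i <= r ^+ m / (1 - r).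
Proof.
move=> r01; rewrite -{1}[m]add0n big_addn.
under eq_bigr do rewrite exprD mulrC.
rewrite -big_distrr /= ler_wpM2l ?exprn_ge0 ?sum_geo_le //.
by case/andP: r01.
Qed.

Lemma real_geo_cvg (x : nat -> R) K r : 0 <= r < 1 ->
  (forall n, `|x n.+1 - x n| <= K * r ^+ n) -> cvgn x.
Proof.
move=> r01 xK.
have K0 : 0 <= K.
  by have := xK 0%N; rewrite expr0 mulr1; apply: le_trans; exact: normr_ge0.
have /cvg_ex[/= l sl] : cvgn (series (fun n => x n.+1 - x n)).
  apply: normed_cvg; apply: (@series_le_cvg _ _ (geometric K r)) => [n|n|n|].
  - exact: normr_ge0.
  - by rewrite /=; apply: mulr_ge0 => //; apply: exprn_ge0; case/andP: r01.
  - exact: xK.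
  apply: is_cvg_geometric_series; rewrite ger0_norm; by case/andP: r01.
apply/cvg_ex; exists (l + x 0%N).
have : (fun n => series (fun n => x n.+1 - x n) n + x 0%N) @ \oo --> l + x 0%N.
  by apply: (@cvgD _ R); [exact: sl|exact: cvg_cst].
have -> // : (fun n => series (fun n => x n.+1 - x n) n + x 0%N) = x.
by apply/funext => n; rewrite /series /= telescope_sumr // subrK.
Qed.

Lemma Re_le_cabs z : `|complex.Re (z : R[i])| <= cabs z.
Proof. by rewrite -lecR -cabsE; exact: normc_ge_Re. Qed.

Lemma Im_le_cabs z : `|complex.Im (z : R[i])| <= cabs z.
Proof.
rewrite -lecR -cabsE normc_def lecR -sqrtr_sqr.
by rewrite ler_wsqrtr // lerDr sqr_ge0.
Qed.

Lemma cabs_le_ReIm z : cabs z <= `|complex.Re (z : R[i])| + `|complex.Im (z : R[i])|.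
Proof.
rewrite /cabs normc_def /= -[X in _ <= X]ger0_norm ?addr_ge0 //.
rewrite -sqrtr_sqr ler_wsqrtr // sqrrD !real_normK ?num_real //.
by rewrite lerD2r lerDl mulrn_wge0 // mulr_ge0.
Qed.

(** The real and imaginary parts inherit the bound on increments, so each converges by
    [real_geo_cvg]. *)
Lemma cplx_geo_cvg (u : nat -> Cplx R) K r : 0 <= r < 1 ->
  (forall n, cabs (u n.+1 - u n) <= K * r ^+ n) -> cvgn u.
Proof.
move=> r01 uK.
have /cvg_ex[/= a /cvgrPdist_lt ca] : cvgn (fun n => complex.Re (u n : R[i])).
  apply: (real_geo_cvg _ K r r01) => n; apply: le_trans (uK n).
  apply: le_trans (Re_le_cabs _); rewrite le_eqVlt; apply/orP; left; apply/eqP.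
  by rewrite raddfB.
have /cvg_ex[/= b /cvgrPdist_lt cb] : cvgn (fun n => complex.Im (u n : R[i])).
  apply: (real_geo_cvg _ K r r01) => n; apply: le_trans (uK n).
  apply: le_trans (Im_le_cabs _); rewrite le_eqVlt; apply/orP; left; apply/eqP.
  by rewrite raddfB.
apply: (cvgP ((a +i* b)%C : Cplx R)); apply/cplx_cvgP => e e0.
have e2 : 0 < e / 2 by lra.
apply: filterS2 (ca _ e2) (cb _ e2) => n ha hb.
apply: le_lt_trans (cabs_le_ReIm _) _.
move: ha hb; case: (u n) => /= c d; lra.
Qed.

(** By 1 + x <= exp x, the product of the factors is at most the exponential of a geometric sum. [M]
    is chosen before [u], so that one bound can serve a whole family of sequences. *)
Lemma prod_geo_bounded K r : 0 <= K -> 0 <= r < 1 ->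
  exists2 M, 0 < M & forall u : nat -> R,
    (forall n, 0 <= u n) -> (forall n, u n.+1 <= u n * (1 + K * r ^+ n)) ->
    forall n, u n <= u 0%N * M.
Proof.
move=> K0 r01; exists (expR (K / (1 - r))); first exact: expR_gt0.
move=> u u0 uK n.
apply: (@le_trans _ _ (u 0%N * expR (K * \sum_(0 <= i < n) r ^+ i))).
  elim: n => [|n IHn]; first by rewrite big_geq // mulr0 expR0 mulr1.
  apply: le_trans (uK n) _; rewrite big_nat_recr //= [K * (_ + _)]mulrDr expRD mulrA.
  have Kr : 0 <= K * r ^+ n by apply: mulr_ge0 => //; apply: exprn_ge0; lra.
  apply: ler_pM => //; [lra|exact: expR_ge1Dx].
apply: ler_wpM2l => //; rewrite ler_expR ler_wpM2l // sum_geo_le //.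
Qed.

End ComplexModulus.

(** * Generating functions of the counts *)

(** Truncated and over any commutative ring: the same recurrences serve over [R], to bound the
    counts, and over [Cplx R], to compute limits. *)
Definition gsum (F : comNzRingType) (x : nat -> nat) (q : F) (M : nat) : F :=
  \sum_(0 <= n < M) (x n)%:R * q ^+ n.
Arguments gsum {F}.

Lemma gsum_add (F : comNzRingType) (x y z : nat -> nat) (q : F) (M : nat) :
  (forall n, z n = (x n + y n)%N) -> gsum z q M = gsum x q M + gsum y q M.
Proof.
move=> zE; rewrite /gsum -big_split /=; apply: eq_bigr => n _.
by rewrite zE natrD mulrDl.
Qed.

Lemma gsum_shift (F : comNzRingType) (x y : nat -> nat) (k : nat) (q : F) (M : nat) :
  (forall n, (n < k)%N -> x n = 0%N) -> (forall n, x (n + k)%N = y n) ->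
  gsum x q (M + k) = q ^+ k * gsum y q M.
Proof.
move=> x0 xy; rewrite /gsum (big_cat_nat (leq0n k) (leq_addl M k)) /=.
rewrite big_nat_cond big1 ?add0r => [|n /andP[/andP[_ /x0 ->] _]]; last by rewrite mul0r.
rewrite -{1}[k]add0n big_addn addnK big_distrr /=; apply: eq_bigr => n _.
by rewrite xy exprD; ring.
Qed.

Lemma gsum_eq_odd (F : comNzRingType) (k : nat) (q : F) (M : nat) :
  gsum (pa_eq_odd k.+1) q (M + k.+1) =
  q ^+ k.+1 * (gsum (pa_eq_even k.+1) q M + gsum (pa_le_odd k) q M).
Proof.
rewrite -(gsum_add _ _ _ (fun n => pa_eq_even k.+1 n + pa_le_odd k n)%N) //.
apply: gsum_shift => n; [exact: pa_eq_odd_small|exact: pa_eq_oddD].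
Qed.

Lemma gsum_eq_even (F : comNzRingType) (k : nat) (q : F) (M : nat) :
  gsum (pa_eq_even k.+1) q (M + k.+1) = q ^+ k.+1 * gsum (pa_eq_odd k.+1) q M.
Proof.
apply: gsum_shift => n; [exact: pa_eq_even_small|exact: pa_eq_evenD].
Qed.

(** * A priori bounds on the counts at a real radius [r < 1] *)

Section RealBounds.
Variable (R : realType) (r : R).
Hypothesis r01 : 0 <= r < 1.

Let r0 : 0 <= r. Proof. by case/andP: r01. Qed.
Let r1 : r < 1. Proof. by case/andP: r01. Qed.

Lemma expr_le_base k : r ^+ k.+1 <= r.
Proof. by rewrite exprS ler_piMr // exprn_ile1 // ltW. Qed.

Lemma gsum_ge0 (x : nat -> nat) M : 0 <= gsum x r M.
Proof. by apply: sumr_ge0 => n _; rewrite mulr_ge0 // exprn_ge0. Qed.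

Lemma gsum_nondec (x : nat -> nat) M k : gsum x r M <= gsum x r (M + k).
Proof.
rewrite {2}/gsum (big_cat_nat (leq0n M) (leq_addr k M)) /= lerDl.
by apply: sumr_ge0 => n _; rewrite mulr_ge0 // exprn_ge0.
Qed.

Lemma gsum_eq_even_le k M :
  gsum (pa_eq_even k.+1) r M <= r ^+ k.+1 * gsum (pa_eq_odd k.+1) r M.
Proof. by rewrite -gsum_eq_even gsum_nondec. Qed.

(** With x = r^(k+1), the truncated recurrences give O <= x (x O + P); since x^2 <= r, this can be
    solved for O. *)
Lemma gsum_eq_odd_le k M :
  gsum (pa_eq_odd k.+1) r M <= gsum (pa_le_odd k) r M * (r ^+ k.+1 / (1 - r)).
Proof.
have := gsum_nondec (pa_eq_odd k.+1) M k.+1; rewrite gsum_eq_odd.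
have := gsum_eq_even_le k M.
have := gsum_ge0 (pa_eq_odd k.+1) M; have := gsum_ge0 (pa_le_odd k) M.
have := expr_le_base k; have : 0 <= r ^+ k.+1 by rewrite exprn_ge0.
move: (gsum (pa_eq_odd _) r M) (gsum (pa_le_odd _) r M) => O P.
move: (gsum (pa_eq_even _) r M) (r ^+ _) => E x x0 xr P0 O0 EO H.
rewrite mulrA ler_pdivlMr; last by have := r1; lra.
have h1 : x * E <= x * (x * O) by rewrite ler_wpM2l.
have h2 : x * (x * O) <= r * O.
  rewrite mulrA ler_wpM2r // -[leRHS]mulr1; apply: ler_pM => //; have := r1; lra.
lra.
Qed.

(** Passing from [k] to [k.+1] multiplies by at most 1 + r^k / (1 - r), so [prod_geo_bounded]
    applies, with a constant independent of the truncation [M] too. *)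
Lemma gsum_le_odd_bounded :
  exists2 K, 0 < K & forall k M, gsum (pa_le_odd k) r M <= K.
Proof.
have ri : 0 <= (1 - r)^-1 by rewrite invr_ge0; have := r1; lra.
have [K K0 HK] := @prod_geo_bounded _ _ _ ri r01.
exists K => // k M.
have H : gsum (pa_le_odd 0) r M <= 1.
  case: M => [|M]; first by rewrite /gsum big_geq.
  rewrite /gsum big_ltn // big_nat_cond big1 ?addr0 => [|n /andP[/andP[n0 _] _]].
    by rewrite pa_le_odd0 eqxx mul1r expr0.
  by rewrite pa_le_odd0; case: n n0 => // n _; rewrite mul0r.
have := HK (fun k => gsum (pa_le_odd k) r M) (fun k => gsum_ge0 _ _) _ k.
move=> /(_ _)/le_trans; apply; last by rewrite ler_piMl // ltW.
move=> n; rewrite (gsum_add _ _ _ _ _ M (pa_le_oddS n)).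
rewrite mulrDr mulr1 lerD2l; apply: le_trans (gsum_eq_odd_le _ _) _.
rewrite ler_wpM2l ?gsum_ge0 // mulrC ler_wpM2l // exprS ler_piMl ?exprn_ge0 //.
exact: ltW.
Qed.

Lemma gsum_pa_eq_bounded : exists2 K, 0 <= K & forall k M,
  gsum (pa_eq_odd k.+1) r M + gsum (pa_eq_even k.+1) r M <= K * r ^+ k.
Proof.
have [K K0 HK] := gsum_le_odd_bounded.
have ri : 0 < (1 - r)^-1 by rewrite invr_gt0; have := r1; lra.
exists (2 * K * (1 - r)^-1); first by rewrite !mulr_ge0 // ltW.
move=> k M.
have x1 := le_trans (expr_le_base k) (ltW r1).
have x0 : 0 <= r ^+ k.+1 by rewrite exprn_ge0.
apply: (@le_trans _ _ (2 * gsum (pa_eq_odd k.+1) r M)).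
  have := gsum_eq_even_le k M; have := gsum_ge0 (pa_eq_odd k.+1) M.
  have : r ^+ k.+1 * gsum (pa_eq_odd k.+1) r M <= gsum (pa_eq_odd k.+1) r M.
    by rewrite ler_piMl ?gsum_ge0.
  lra.
rewrite -!mulrA ler_wpM2l //; apply: le_trans (gsum_eq_odd_le _ _) _.
apply: ler_pM; rewrite ?gsum_ge0 ?HK //; first by rewrite mulr_ge0 // ltW.
rewrite mulrC ler_wpM2l ?(ltW ri) //.
by rewrite exprS ler_piMl ?exprn_ge0 ?(ltW r1).
Qed.

(** By positivity, each count in [pa_sum] contributes at most the whole truncated sum containing it,
    and these sums decay geometrically in the number of parts. *)
Lemma pa_geo_bounded : exists2 K, 0 <= K & forall n, (pa n)%:R * r ^+ n <= K.
Proof.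
have [K K0 HK] := gsum_pa_eq_bounded.
have ri : 0 <= (1 - r)^-1 by rewrite invr_ge0; have := r1; lra.
exists ((pa 0)%:R + K / (1 - r)); first by rewrite addr_ge0 // mulr_ge0.
case=> [|n]; first by rewrite expr0 mulr1 lerDl mulr_ge0.
apply: le_trans (_ : K / (1 - r) <= _); last by rewrite lerDr.
rewrite (pa_sum n.+1 n.+1) //.
apply: (@le_trans _ _ (\sum_(1 <= k < n.+2)
   (gsum (pa_eq_odd k) r n.+2 + gsum (pa_eq_even k) r n.+2))).
  rewrite natr_sum big_distrl /=; apply: ler_sum => k _.
  rewrite -(gsum_add _ _ _ (fun n => pa_eq_odd k n + pa_eq_even k n)%N) //.
  rewrite /gsum [leRHS]big_nat_recr //= lerDr.
  by apply: sumr_ge0 => m _; rewrite mulr_ge0 // exprn_ge0.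
rewrite big_add1 /=.
apply: (@le_trans _ _ (\sum_(0 <= k < n.+1) K * r ^+ k)).
  by apply: ler_sum => k _; exact: HK.
by rewrite -big_distrr ler_wpM2l //; exact: sum_geo_le.
Qed.

End RealBounds.

(** Boundedness at the larger radius [t], midway between [r] and 1, becomes decay of ratio [r / t]
    at [r]. *)
Lemma pa_geo_decay (R : realType) (r : R) : 0 <= r < 1 ->
  exists K s, [/\ 0 <= K, 0 <= s < 1 & forall n, (pa n)%:R * r ^+ n <= K * s ^+ n].
Proof.
move=> /andP[r0 r1]; pose t := (1 + r) / 2.
have t01 : 0 <= t < 1 by rewrite /t; lra.
have t0 : 0 < t by rewrite /t; lra.
have [K K0 HK] := pa_geo_bounded _ _ t01.
exists K, (r / t); split=> //.
  apply/andP; split; first by rewrite divr_ge0 // ltW.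
  by rewrite ltr_pdivrMr // mul1r /t; lra.
move=> n; have -> : r ^+ n = t ^+ n * (r / t) ^+ n.
  by rewrite -exprMn; congr (_ ^+ _); field; lra.
by rewrite mulrA ler_wpM2r // exprn_ge0 // divr_ge0 // ltW.
Qed.

(** * Recurrences and limit laws for partial sums and products *)

Lemma pprod0 (C : numClosedFieldType) (u : nat -> C) : pprod u 0 = 1.
Proof. by rewrite /pprod big_geq. Qed.

Lemma pprodS (C : numClosedFieldType) (u : nat -> C) N :
  pprod u N.+1 = pprod u N * u N.+1.
Proof. by rewrite /pprod big_nat_recr. Qed.

Lemma psum0 (C : numClosedFieldType) (u : nat -> C) : psum u 0 = 0.
Proof. by rewrite /psum big_geq. Qed.

Lemma psumS (C : numClosedFieldType) (u : nat -> C) N :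
  psum u N.+1 = psum u N + u N.+1.
Proof. by rewrite /psum big_nat_recr. Qed.

Lemma cvgn_ext (T : topologicalType) (u v : nat -> T) (l : T) :
  (forall n, u n = v n) -> v @ \oo --> l -> u @ \oo --> l.
Proof. by move=> /funext ->. Qed.

Lemma cvgnM (C : numClosedFieldType) (u v : nat -> C) (a b : C) :
  u @ \oo --> a -> v @ \oo --> b -> (fun n => u n * v n) @ \oo --> a * b.
Proof. by move=> ua vb; exact: cvgM. Qed.

Lemma cvgnD (C : numClosedFieldType) (u v : nat -> C) (a b : C) :
  u @ \oo --> a -> v @ \oo --> b -> (fun n => u n + v n) @ \oo --> a + b.
Proof. by move=> ua vb; exact: cvgD. Qed.

Lemma cvgnV (C : numClosedFieldType) (u : nat -> C) (a : C) :
  a != 0 -> u @ \oo --> a -> (fun n => (u n)^-1) @ \oo --> a^-1.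
Proof. by move=> a0 ua; exact: cvgV. Qed.

Lemma cvg_psum (C : numClosedFieldType) (f : nat -> nat -> C) (l : nat -> C) N :
  (forall k, f k.+1 @ \oo --> l k.+1) ->
  (fun M => psum (fun k => f k M) N) @ \oo --> psum l N.
Proof.
move=> fl; elim: N => [|N IHN].
  rewrite psum0; apply: (@cvgn_ext C _ (fun=> 0)); last exact: cvg_cst.
  by move=> M; rewrite psum0.
rewrite psumS; apply: (@cvgn_ext C _ (fun M => psum (fun k => f k M) N + f N.+1 M)).
  by move=> M; rewrite psumS.
exact: cvgnD.
Qed.

(* Otherwise unification may try to evaluate the counts. *)
Local Opaque pa pa_eq_odd pa_eq_even pa_le_odd.

(** * Limits of the generating functions by number of parts *)

Section GeneratingFunction.
Variables (R : realType) (q : Cplx R).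
Hypothesis hq : cabs q < 1.

Let q01 : 0 <= cabs q < 1. Proof. by rewrite cabs_ge0. Qed.

Lemma cabs_expr_lt1 k : cabs (q ^+ k.+1) < 1.
Proof. by rewrite cabsX; apply: le_lt_trans hq; exact: expr_le_base. Qed.

Lemma one_sub_neq0 (x : Cplx R) : cabs x < 1 -> 1 - x != 0.
Proof.
move=> x1; rewrite -cabs_gt0; apply: lt_le_trans (ler_cabs_sub _ _ _).
by rewrite cabs1 subr_gt0.
Qed.

Lemma one_sub_expr_neq0 k : 1 - q ^+ k.+1 != 0.
Proof. exact/one_sub_neq0/cabs_expr_lt1. Qed.

Lemma one_add_expr_neq0 k : 1 + q ^+ k.+1 != 0.
Proof.
by rewrite -[q ^+ _]opprK; apply: one_sub_neq0; rewrite cabsN cabs_expr_lt1.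
Qed.

Lemma cvg_gsum (x : nat -> nat) : (forall n, (x n <= pa n)%N) -> cvgn (gsum x q).
Proof.
move=> xpa; have [K [s [K0 s01 HK]]] := pa_geo_decay _ _ q01.
apply: (@cplx_geo_cvg _ _ K s) => // n.
rewrite /gsum big_nat_recr //= addrAC subrr add0r cabsM cabs_nat cabsX.
apply: le_trans (HK n); rewrite ler_wpM2r ?exprn_ge0 ?cabs_ge0 //.
by rewrite ler_nat.
Qed.

(** Both limits exist, the counts being at most [pa]. With x = q^(k+1), the truncated recurrences
    become o = x (e + P) and e = x o in the limit, a linear system solved for o. *)
Lemma cvg_pa_eq_odd k (P : Cplx R) : gsum (pa_le_odd k) q @ \oo --> P ->
  gsum (pa_eq_odd k.+1) q @ \oo --> P * q ^+ k.+1 / (1 - q ^+ (2 * k.+1)) /\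
  gsum (pa_eq_even k.+1) q @ \oo -->
    q ^+ k.+1 * (P * q ^+ k.+1 / (1 - q ^+ (2 * k.+1))).
Proof.
move=> pP.
have [o oE] : exists o : Cplx R, gsum (pa_eq_odd k.+1) q @ \oo --> o.
  exists (limn (gsum (pa_eq_odd k.+1) q)); apply: cvg_gsum => n.
  exact: leq_pa_count.
have [e eE] : exists e : Cplx R, gsum (pa_eq_even k.+1) q @ \oo --> e.
  exists (limn (gsum (pa_eq_even k.+1) q)); apply: cvg_gsum => n.
  exact: leq_pa_count.
have ho : o = q ^+ k.+1 * (e + P).
  (* The truncations on the two sides of the recurrence differ by [k.+1]; the shift leaves the limit
     unchanged. *)
  apply: (@cvg_unique (Cplx R) _ ((fun M => gsum (pa_eq_odd k.+1) q (M + k.+1)) @ \oo)).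
  - exact: norm_hausdorff.
  - by move: oE; rewrite -(@cvg_shiftn k.+1).
  apply: cvgn_ext; first by move=> M; exact: gsum_eq_odd.
  apply: (@cvgnM (Cplx R) (fun=> q ^+ k.+1)).
    exact: cvg_cst.
  exact: (@cvgnD (Cplx R) _ _ _ _ eE pP).
have he : e = q ^+ k.+1 * o.
  apply: (@cvg_unique (Cplx R) _ ((fun M => gsum (pa_eq_even k.+1) q (M + k.+1)) @ \oo)).
  - exact: norm_hausdorff.
  - by move: eE; rewrite -(@cvg_shiftn k.+1).
  apply: cvgn_ext; first by move=> M; exact: gsum_eq_even.
  by apply: cvgnM; [exact: cvg_cst|exact: oE].
have oP : o = P * q ^+ k.+1 / (1 - q ^+ (2 * k.+1)).
  have n0 : 1 - q ^+ (2 * k.+1) != 0.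
    by rewrite mulnS; exact: one_sub_expr_neq0.
  apply: (mulIf n0); rewrite divfK // mulnC exprM.
  move: he ho; move: (q ^+ k.+1) => x -> ho.
  rewrite mulrBr mulr1 {1}ho; ring.
by rewrite -oP -he.
Qed.

(** Allowing one more part multiplies the limit by 1 + x/(1 - x^2) with x = q^(k+1), which is the
    next factor of the product. *)
Lemma cvg_pa_le_odd k : gsum (pa_le_odd k) q @ \oo --> pprod (prod_factor q) k.
Proof.
elim: k => [|k IHk].
  rewrite pprod0; apply/cplx_cvgP => e e0; exists 1%N => // -[//|M] _ /=.
  rewrite /gsum big_ltn // big_nat_cond big1 ?addr0 => [|n /andP[/andP[n0 _] _]].
    by rewrite pa_le_odd0 eqxx mul1r expr0 subrr cabs0.
  by rewrite pa_le_odd0; case: n n0 => // n _; rewrite mul0r.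
have [oE _] := cvg_pa_eq_odd k _ IHk.
rewrite pprodS (_ : _ * _ = pprod (prod_factor q) k +
  pprod (prod_factor q) k * q ^+ k.+1 / (1 - q ^+ (2 * k.+1))).
  rewrite (_ : gsum _ q = fun M => gsum (pa_le_odd k) q M + gsum (pa_eq_odd k.+1) q M).
    exact: (@cvgnD (Cplx R) _ _ _ _ IHk oE).
  by apply/funext => M; apply: gsum_add => n; exact: pa_le_oddS.
rewrite /prod_factor; field.
by rewrite mulnS; exact: one_sub_expr_neq0.
Qed.

(** For [k > 0], the generating function of the partitions with exactly [k] parts, as [cvg_pa_eq]
    shows. *)
Definition pa_parts_gf (k : nat) : Cplx R :=
  pprod (prod_factor q) k.-1 * (q ^+ k / (1 - q ^+ k)).

(** With x = q^(k+1), the odd and even cases add up to (1 + x) P x/(1 - x^2), and 1 + x cancels. *)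
Lemma cvg_pa_eq k :
  (fun M => gsum (pa_eq_odd k.+1) q M + gsum (pa_eq_even k.+1) q M) @ \oo
    --> pa_parts_gf k.+1.
Proof.
have [oE eE] := cvg_pa_eq_odd k _ (cvg_pa_le_odd k).
rewrite /pa_parts_gf /=.
have -> : pprod (prod_factor q) k * (q ^+ k.+1 / (1 - q ^+ k.+1)) =
  pprod (prod_factor q) k * q ^+ k.+1 / (1 - q ^+ (2 * k.+1)) +
    q ^+ k.+1 * (pprod (prod_factor q) k * q ^+ k.+1 / (1 - q ^+ (2 * k.+1))).
  have := one_sub_expr_neq0 k; have := one_add_expr_neq0 k.
  have : 1 - q ^+ (2 * k.+1) != 0.
    by rewrite mulnS; exact: one_sub_expr_neq0.
  rewrite mulnC exprM; move: (q ^+ k.+1) => x h1 h2 h3; field.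
  by rewrite h1.
exact: (@cvgnD (Cplx R) _ _ _ _ oE eE).
Qed.

(** Sums over at most [N] parts are compared with sums over [n <= N]. The coefficients agree for 0 <
    n <= N, as a partition of [n] has at most [n] parts; beyond [N] they are at most [pa n], so the
    difference is bounded by a geometric tail. *)
Lemma psum_pa_approx : exists K s, [/\ 0 <= K, 0 <= s < 1 &
  forall N, cabs (psum pa_parts_gf N - psum (pa_term q) N) <= K * s ^+ N].
Proof.
have [K [s [K0 s01 HK]]] := pa_geo_decay _ _ q01.
have [s0 s1] := andP s01.
exists (K / (1 - s)), s; split => //; first by rewrite divr_ge0 // subr_ge0 ltW.
move=> N; pose b k n := (pa_eq_odd k n + pa_eq_even k n)%N.
have gb k M : gsum (pa_eq_odd k) q M + gsum (pa_eq_even k) q M = gsum (b k) q M.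
  by rewrite -(gsum_add _ _ _ (b k)).
(* With [N] fixed, each generating function is replaced by its truncation at [M > N]; the bound
   obtained does not depend on [M]. *)
apply: (@cabs_cvg_le _ (fun M => psum (fun k => gsum (b k) q M) N)).
  apply: cvg_psum => k.
  by apply: cvgn_ext (cvg_pa_eq k) => M; rewrite gb.
exists N.+1 => // M /= NM.
have -> : psum (fun k => gsum (b k) q M) N =
    \sum_(1 <= n < M) (\sum_(1 <= k < N.+1) b k n)%:R * q ^+ n.
  under [RHS]eq_bigr do rewrite natr_sum big_distrl /=.
  rewrite exchange_big /=; apply: eq_big_nat => k /andP[k0 _].
  rewrite /gsum [LHS]big_ltn ?(leq_trans _ NM) // /b.
  rewrite pa_eq_odd_small // pa_eq_even_small //.
  by rewrite mul0r add0r.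
rewrite (big_cat_nat _ NM) //= /psum [X in X + _ - _](_ : _ =
  \sum_(1 <= n < N.+1) pa_term q n); last first.
  apply: eq_big_nat => n /andP[n0 nN]; rewrite /pa_term (pa_sum n N) //.
rewrite addrAC subrr add0r.
apply: le_trans (ler_cabs_sum _ _ _ _ _) _.
apply: (@le_trans _ _ (\sum_(N.+1 <= n < M) K * s ^+ n)).
  apply: ler_sum_nat => n /andP[n0 _]; rewrite cabsM cabs_nat cabsX.
  apply: le_trans (HK n); rewrite ler_wpM2r ?exprn_ge0 ?cabs_ge0 //.
  by rewrite ler_nat; apply: sum_pa_eq_le; exact: leq_ltn_trans n0.
rewrite -big_distrr /= -mulrA ler_wpM2l //.
apply: le_trans (sum_geo_from_le _ _ _ _ s01) _; rewrite mulrC ler_wpM2l //.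
  by rewrite invr_ge0 subr_ge0 ltW.
by rewrite exprS ler_piMl ?exprn_ge0 // ltW.
Qed.

End GeneratingFunction.

(** * The transformation of the basic hypergeometric series *)

Section Telescoping.
Variables (F : fieldType) (q a f : F).
Hypothesis af : a * f = 1.
Hypothesis c_neq0 : forall n, 1 + q ^+ n != 0.
Hypothesis e_neq0 : forall n, 1 - q ^+ n.+1 != 0.

(** In q-Pochhammer notation, [alphaq n] is (a;q)_n/(q;q)_n, [betaq n] is (aq;q)_n/(q;q)_n and
    [deltaq n] is (-f;q)_n/(-1;q)_n. *)
Definition alphaq n : F := \prod_(0 <= j < n) ((1 - a * q ^+ j) / (1 - q ^+ j.+1)).
Definition betaq n : F := \prod_(0 <= j < n) ((1 - a * q ^+ j.+1) / (1 - q ^+ j.+1)).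
Definition deltaq n : F := \prod_(0 <= j < n) ((1 + f * q ^+ j) / (1 + q ^+ j)).

Lemma alphaqS n : alphaq n.+1 = alphaq n * ((1 - a * q ^+ n) / (1 - q ^+ n.+1)).
Proof. by rewrite /alphaq big_nat_recr. Qed.
Lemma betaqS n : betaq n.+1 = betaq n * ((1 - a * q ^+ n.+1) / (1 - q ^+ n.+1)).
Proof. by rewrite /betaq big_nat_recr. Qed.
Lemma deltaqS n : deltaq n.+1 = deltaq n * ((1 + f * q ^+ n) / (1 + q ^+ n)).
Proof. by rewrite /deltaq big_nat_recr. Qed.

Lemma alphaq_betaq n : alphaq n.+1 = (1 - a) * betaq n / (1 - q ^+ n.+1).
Proof.
elim: n => [|n IHn].
  by rewrite /alphaq /betaq big_nat1 big_geq // expr0 !mulr1.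
rewrite alphaqS IHn betaqS; field.
by rewrite !e_neq0.
Qed.

(** The truncated 2phi1 series at b = -f q^m, where ab = -q^m, multiplied by [deltaq m]; with this
    normalization changing [m] only shifts the index of [deltaq]. *)
Definition heine_sum m N : F :=
  \sum_(0 <= n < N.+1) alphaq n * q ^+ n * deltaq (m + n).

(* The contiguous relation in the parameter [b] of the series
   2phi1(a, b; ab; q, q) at [b = - f q ^+ m]: its inhomogeneous part telescopes. *)
Lemma heine_sum_rec m N :
  (1 + f * q ^+ m) * (heine_sum m N - a * heine_sum m.+1 N) =
  (1 - a) * deltaq (m + N.+1) * betaq N.
Proof.
have a0 : a != 0.
  by apply/eqP => a0; move/eqP: af; rewrite a0 mul0r eq_sym oner_eq0.
have fE : f = a^-1 by apply: (mulfI a0); rewrite af divff.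
(* As [a * f = 1], the powers of [q] cancel in the numerator 1 + q^n - a (1 + f q^n). *)
have step n : deltaq n - a * deltaq n.+1 = deltaq n * (1 - a) / (1 + q ^+ n).
  by rewrite deltaqS fE; field; rewrite c_neq0 a0.
have dif N' : heine_sum m N' - a * heine_sum m.+1 N' =
    \sum_(0 <= n < N'.+1) alphaq n * q ^+ n *
      (deltaq (m + n) * (1 - a) / (1 + q ^+ (m + n))).
  rewrite /heine_sum big_distrr /= -sumrB; apply: eq_bigr => n _.
  by rewrite -step addSn; ring.
rewrite dif; elim: N => [|N IHN].
  rewrite big_nat1 addn0 addn1 deltaqS /alphaq /betaq !big_geq // expr0.
  by rewrite fE; field; rewrite c_neq0 a0.
rewrite big_nat_recr //= mulrDr IHN alphaq_betaq betaqS [(m + N.+2)%N]addnS deltaqS.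
move: (e_neq0 N) (c_neq0 (m + N.+1)); rewrite exprD fE => e0 c0; field.
by rewrite c0 a0 e0.
Qed.

(** Applies [heine_sum_rec] [M] times, each time dividing by [1 + f * q ^+ m]. *)
Lemma heine_sum_iter N M : (forall m, 1 + f * q ^+ m != 0) ->
  heine_sum 0 N = a ^+ M * heine_sum M N +
    (1 - a) * betaq N *
    \sum_(0 <= m < M) a ^+ m / (1 + f * q ^+ m) * deltaq (m + N.+1).
Proof.
move=> d_neq0; elim: M => [|M IHM]; first by rewrite big_geq // mul1r mulr0 addr0.
rewrite IHM big_nat_recr //= mulrDr addrA.
have -> : heine_sum M N = a * heine_sum M.+1 N +
    (1 - a) * deltaq (M + N.+1) * betaq N / (1 + f * q ^+ M).
  by rewrite -heine_sum_rec; field.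
by rewrite exprS; ring.
Qed.

End Telescoping.

(** * The golden ratio and its inverse *)

Section Golden.
Variable C : numClosedFieldType.

Definition golden : C := (sqrt5 C + 1) / 2.
Definition golden_inv : C := (sqrt5 C - 1) / 2.

Lemma sqr_sqrt5 : sqrt5 C ^+ 2 = 5.
Proof. exact: sqrtCK. Qed.

Lemma golden_invM : golden_inv * golden = 1.
Proof.
rewrite /golden_inv /golden.
have -> : (sqrt5 C - 1) / 2 * ((sqrt5 C + 1) / 2) = (sqrt5 C ^+ 2 - 1) / 4 by field.
by rewrite sqr_sqrt5; field.
Qed.

Lemma goldenE : golden = 1 + golden_inv.
Proof. by rewrite /golden_inv /golden; field. Qed.

Lemma golden_gt0 : 0 < golden.
Proof.
rewrite divr_gt0 // ?ltr0n // ltr_wpDl //.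
by rewrite sqrtC_ge0 ler0n.
Qed.

Lemma golden_inv_gt0 : 0 < golden_inv.
Proof.
by rewrite -(pmulr_lgt0 _ golden_gt0) golden_invM ltr01.
Qed.

(** Writing a for [golden_inv], 1 = a (1 + a) = a + a^2 with a > 0. *)
Lemma golden_inv_lt1 : golden_inv < 1.
Proof.
rewrite -golden_invM goldenE mulrDr mulr1 ltrDl.
by rewrite mulr_gt0 ?golden_inv_gt0.
Qed.

Lemma golden_inv_sqr : (3 - sqrt5 C) / 2 = golden_inv ^+ 2.
Proof.
have -> : golden_inv ^+ 2 = (sqrt5 C ^+ 2 - 2 * sqrt5 C + 1) / 4.
  by rewrite /golden_inv; field.
by rewrite sqr_sqrt5; field.
Qed.

Lemma golden_sqr : (3 + sqrt5 C) / 2 = golden ^+ 2.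
Proof.
have -> : golden ^+ 2 = (sqrt5 C ^+ 2 + 2 * sqrt5 C + 1) / 4.
  by rewrite /golden; field.
by rewrite sqr_sqrt5; field.
Qed.

End Golden.

(** * Uniform bounds for products, increments and inverses *)

Section Bounds.
Variable R : realType.

(** Common pattern of the partial products and of [alphaq], [betaq], [deltaq]: each factor is 1 plus
    a geometrically small term. [prod_geo_bounded] bounds the moduli, and then the increments. *)
Lemma ratio_bounded (u x y : nat -> Cplx R) (K r : R) : 0 <= r < 1 ->
  (forall n, u n.+1 = u n * (1 + x n / y n)) ->
  (forall n, cabs (x n) <= K * r ^+ n) -> (forall n, 1 - r <= cabs (y n)) ->
  exists2 M, 0 <= M & forall n, cabs (u n) <= M /\ cabs (u n.+1 - u n) <= M * r ^+ n.
Proof.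
move=> r01 uS xK yr; have [r0 r1] := andP r01.
have r1' : 0 < 1 - r by lra.
have K0 : 0 <= K.
  by have := xK 0%N; rewrite expr0 mulr1; apply: le_trans; exact: cabs_ge0.
pose L := K / (1 - r); have L0 : 0 <= L by rewrite divr_ge0 // ltW.
have xy n : cabs (x n / y n) <= L * r ^+ n.
  rewrite cabsM cabsV /L mulrAC; apply: ler_pM; rewrite ?invr_ge0 ?cabs_ge0 //.
  by rewrite lef_pV2 ?posrE //; apply: lt_le_trans (yr n).
have [M M0 HM] := @prod_geo_bounded _ _ _ L0 r01.
have uM n : cabs (u n) <= cabs (u 0%N) * M.
  apply: (HM (fun n => cabs (u n))) => k; first exact: cabs_ge0.
  rewrite uS cabsM ler_wpM2l ?cabs_ge0 //.
  by apply: le_trans (ler_cabsD _ _ _) _; rewrite cabs1 lerD2l.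
have B0 : 0 <= cabs (u 0%N) * M by rewrite mulr_ge0 ?cabs_ge0 // ltW.
exists (cabs (u 0%N) * M * (1 + L)); first by rewrite mulr_ge0 // addr_ge0.
move=> n; split; first by apply: le_trans (uM n) _; rewrite ler_peMr // lerDl.
rewrite uS mulrDr mulr1 addrAC subrr add0r cabsM.
apply: le_trans (_ : _ <= cabs (u 0%N) * M * (L * r ^+ n)) _.
  by apply: ler_pM; rewrite ?cabs_ge0.
by rewrite mulrA ler_wpM2r ?exprn_ge0 // ler_wpM2l // lerDr.
Qed.

Lemma incr_dist_le (u : nat -> Cplx R) (K r : R) : 0 <= r < 1 ->
  (forall n, cabs (u n.+1 - u n) <= K * r ^+ n) ->
  forall j i, cabs (u (i + j)%N - u i) <= K * r ^+ i / (1 - r).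
Proof.
move=> r01 uK j i.
have K0 : 0 <= K.
  by have := uK 0%N; rewrite expr0 mulr1; apply: le_trans; exact: cabs_ge0.
rewrite -(telescope_sumr u (leq_addr j i)).
apply: le_trans (ler_cabs_sum _ _ _ _ _) _.
apply: (@le_trans _ _ (\sum_(i <= k < i + j) K * r ^+ k)).
  by apply: ler_sum => k _; exact: uK.
by rewrite -big_distrr /= -mulrA ler_wpM2l // sum_geo_from_le.
Qed.

(** From some [N] on the inverses are within 1 of their limit 1, hence of modulus at most 2; the sum
    in the witness covers the indices below [N]. *)
Lemma inv_bounded (d : nat -> Cplx R) :
  (forall n, d n != 0) -> d @ \oo --> (1 : Cplx R) ->
  exists2 K, 0 <= K & forall n, cabs (d n)^-1 <= K.
Proof.
move=> d0 /(@cvgnV (Cplx R) _ _ (oner_neq0 _)); rewrite invr1.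
move=> /cplx_cvgP /(_ 1 ltr01) [N _ HN].
have S0 n : 0 <= \sum_(0 <= k < n) cabs (d k)^-1.
  by apply: sumr_ge0 => k _; exact: cabs_ge0.
exists (2 + \sum_(0 <= k < N) cabs (d k)^-1); first by rewrite addr_ge0.
move=> n; case: (leqP N n) => [/HN /= h|nN].
  apply: (@le_trans _ _ 2); last by rewrite lerDl.
  have := ler_cabs_sub _ (d n)^-1 1; rewrite cabsB cabs1; lra.
rewrite (bigD1_seq n) ?mem_index_iota ?iota_uniq //= addrCA lerDl addr_ge0 //.
by apply: sumr_ge0 => k _; exact: cabs_ge0.
Qed.

End Bounds.

(** * The limiting form of the transformation at the golden ratio *)

Section Identity.
Variables (R : realType) (q : Cplx R).
Hypothesis hq : cabs q < 1.

Let r := cabs q.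
Let a := golden_inv (Cplx R).
Let f := golden (Cplx R).

Let r01 : 0 <= r < 1. Proof. by rewrite cabs_ge0. Qed.
Let r0 : 0 <= r. Proof. exact: cabs_ge0. Qed.

Let af : a * f = 1. Proof. exact: golden_invM. Qed.

Lemma cabs_golden_inv : cabs a < 1.
Proof.
rewrite -normr_lt_cabs (gtr0_norm (golden_inv_gt0 _)).
exact: golden_inv_lt1.
Qed.

Let a01 : 0 <= cabs a < 1. Proof. by rewrite cabs_ge0 cabs_golden_inv. Qed.

Let c_neq0 n : 1 + q ^+ n != 0.
Proof.
case: n => [|n]; last exact: one_add_expr_neq0.
by rewrite expr0 -(natrD _ 1 1) pnatr_eq0.
Qed.

Let e_neq0 n : 1 - q ^+ n.+1 != 0. Proof. exact: one_sub_expr_neq0. Qed.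

Lemma cabs_one_sub_ge (x : Cplx R) : cabs x <= r -> 1 - r <= cabs (1 - x).
Proof. by move=> xr; have := ler_cabs_sub _ 1 x; rewrite cabs1; lra. Qed.

Lemma cabs_expr_le n : cabs (q ^+ n.+1) <= r.
Proof. by rewrite cabsX; exact: expr_le_base. Qed.

Lemma expr_succ_le n : r ^+ n.+1 <= r ^+ n.
Proof. by rewrite exprS ler_piMl ?exprn_ge0 // ltW. Qed.

Lemma prod_factor_bounded : exists2 M, 0 <= M & forall n,
  cabs (pprod (prod_factor q) n) <= M /\
  cabs (pprod (prod_factor q) n.+1 - pprod (prod_factor q) n) <= M * r ^+ n.
Proof.
apply: (@ratio_bounded _ _ (fun n => q ^+ n.+1) (fun n => 1 - q ^+ (2 * n.+1)) 1) => // n.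
- rewrite pprodS; congr (_ * _); rewrite /prod_factor; field.
  by rewrite mulnS; exact: e_neq0.
- by rewrite cabsX mul1r expr_succ_le.
- by rewrite mulnS; exact/cabs_one_sub_ge/cabs_expr_le.
Qed.

Lemma alphaq_bounded : exists2 M, 0 <= M & forall n, cabs (alphaq _ q a n) <= M.
Proof.
have [||||M M0 HM] := @ratio_bounded _ (alphaq _ q a)
  (fun n => q ^+ n.+1 - a * q ^+ n) (fun n => 1 - q ^+ n.+1) 2 r.
- by [].
- by move=> n; rewrite alphaqS; congr (_ * _); field.
- move=> n; apply: le_trans (ler_cabsD _ _ _) _; rewrite cabsN cabsM !cabsX.
  have := expr_succ_le n; have /andP[a0 a1] := a01.
  have : cabs a * r ^+ n <= r ^+ n by rewrite ler_piMl ?exprn_ge0 // ltW.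
  rewrite -/r; lra.
- by move=> n; exact/cabs_one_sub_ge/cabs_expr_le.
by exists M => // n; case: (HM n).
Qed.

Lemma betaq_bounded : exists2 M, 0 <= M & forall n, cabs (betaq _ q a n) <= M.
Proof.
have [||||M M0 HM] := @ratio_bounded _ (betaq _ q a)
  (fun n => (1 - a) * q ^+ n.+1) (fun n => 1 - q ^+ n.+1) (cabs (1 - a)) r.
- by [].
- by move=> n; rewrite betaqS; congr (_ * _); field.
- by move=> n; rewrite cabsM cabsX ler_wpM2l ?cabs_ge0 // expr_succ_le.
- by move=> n; exact/cabs_one_sub_ge/cabs_expr_le.
by exists M => // n; case: (HM n).
Qed.

Lemma deltaq_bounded : exists2 M, 0 <= M & forall n,
  cabs (deltaq _ q f n) <= M /\
  cabs (deltaq _ q f n.+1 - deltaq _ q f n) <= M * r ^+ n.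
Proof.
apply: (@ratio_bounded _ _ (fun n => (f - 1) * q ^+ n) (fun n => 1 + q ^+ n)
  (cabs (f - 1))) => // n.
- by rewrite deltaqS; congr (_ * _); field.
- by rewrite cabsM cabsX.
(* Only positive powers of [q] have modulus at most [r]; at [n = 0] the denominator is 2. *)
- rewrite -[q ^+ n]opprK; case: n => [|n]; last first.
    by apply: cabs_one_sub_ge; rewrite cabsN; exact: cabs_expr_le.
  rewrite expr0 opprK -(natrD _ 1 1) cabs_nat.
  by have := r0; lra.
Qed.

(** As f - a = a f = 1, one has 1 + x - x^2 = (1 - a x)(1 + f x). At [N = 0], the 2 cancels the
    denominator 1 + q^0 of [deltaq], and (1 - a)(1 + f) = 1. *)
Lemma betaq_deltaq N :
  2 * ((1 - a) * betaq _ q a N * deltaq _ q f N.+1) = pprod (prod_factor q) N.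
Proof.
have fE : f = 1 + a := goldenE _.
elim: N => [|N IHN].
  rewrite pprod0 /betaq /deltaq big_geq // big_nat1 expr0 !mulr1.
  have -> : 2 * ((1 - a) * ((1 + f) / (1 + 1))) = 1 + f - a - a * f by field.
  by rewrite af fE; ring.
rewrite pprodS -IHN betaqS (deltaqS _ _ _ N.+1) /prod_factor.
have -> : 1 + q ^+ N.+1 - q ^+ (2 * N.+1) = (1 - a * q ^+ N.+1) * (1 + f * q ^+ N.+1).
  rewrite [RHS](_ : _ = 1 + (f - a) * q ^+ N.+1 - a * f * q ^+ (2 * N.+1)).
    by rewrite af fE addrK !mul1r.
  by rewrite mulnC exprM; ring.
move: (c_neq0 N.+1) (e_neq0 N); rewrite mulnC exprM; move: (q ^+ N.+1) => x x1 x2.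
by field; rewrite x1 x2 /= (_ : 1 - x ^+ 2 = (1 - x) * (1 + x)) ?mulf_neq0 //; ring.
Qed.

(** By [alphaq_betaq] and [betaq_deltaq], the term of index [k > 0] on the left is [pa_parts_gf k];
    the term of index 0 is the constant 2, the source of the [- 2] in [rhs]. *)
Lemma heine_sum_parts N :
  2 * heine_sum _ q a f 0 N = 2 + psum (pa_parts_gf _ q) N.
Proof.
elim: N => [|N IHN].
  rewrite psum0 /heine_sum big_nat1 /alphaq /deltaq !big_geq // expr0; ring.
rewrite psumS addrA -IHN {1}/heine_sum big_nat_recr //= mulrDr; congr (_ + _).
rewrite alphaq_betaq // /pa_parts_gf /= -betaq_deltaq add0n; field.
exact: e_neq0.
Qed.

Hypothesis d_neq0 : forall n, 1 + f * q ^+ n != 0.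

Lemma golden_denom_bounded :
  exists2 K, 0 <= K & forall n, cabs (1 + f * q ^+ n)^-1 <= K.
Proof.
apply: inv_bounded => //.
apply: (@cplx_cvg_squeeze _ _ (fun n => cabs f * r ^+ n)); last exact: cvg_geo.
by move=> n; rewrite opprD addrA subrr sub0r cabsN cabsM cabsX.
Qed.

(** The sum truncated at [N] is iterated [N.+1] times. The remainder carries the factor a^(N+1)
    times a bounded sum; in the other part [deltaq (m + N.+1)] is close to [deltaq N.+1], which
    factors out and forms the product by [betaq_deltaq]. *)
Lemma heine_limit :
  (fun N => 2 + psum (pa_parts_gf _ q) N -
    pprod (prod_factor q) N * \sum_(0 <= m < N.+1) a ^+ m / (1 + f * q ^+ m))
  @ \oo --> (0 : Cplx R).
Proof.
have [A A0 HA] := alphaq_bounded.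
have [B B0 HB] := betaq_bounded.
have [D D0 HD] := deltaq_bounded.
have [E E0 HE] := golden_denom_bounded.
have [a0 a1] := andP a01.
have r1 : 0 < 1 - r by rewrite subr_gt0.
have a1' : 0 < 1 - cabs a by rewrite subr_gt0.
(* [K1] bounds the remainder, [K2] the cost of replacing every [deltaq (m + N.+1)] by
   [deltaq N.+1]. *)
pose K1 := cabs (2 : Cplx R) * (cabs a * (A * D / (1 - r))).
pose K2 := cabs (2 * (1 - a)) * B * (E / (1 - cabs a) * (D / (1 - r))).
apply: (@cplx_cvg_squeeze _ _ (fun N => K1 * cabs a ^+ N + K2 * r ^+ N)); last first.
  rewrite -[X in _ --> X]addr0.
  by apply: (@cvgD _ R); apply: cvg_geo.
move=> N; rewrite sub0r cabsN -heine_sum_parts.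
rewrite (heine_sum_iter _ q a f af c_neq0 e_neq0 N N.+1 d_neq0) -betaq_deltaq.
set V := heine_sum _ _ _ _ _ _.
set S := \sum_(0 <= m < _) _; set T := \sum_(0 <= m < _) _.
have -> : 2 * (a ^+ N.+1 * V + (1 - a) * betaq _ q a N * S) -
    2 * ((1 - a) * betaq _ q a N * deltaq _ q f N.+1) * T =
    2 * (a ^+ N.+1 * V) + 2 * (1 - a) * betaq _ q a N * (S - deltaq _ q f N.+1 * T).
  by ring.
have HV : cabs V <= A * D / (1 - r).
  apply: le_trans (ler_cabs_sum _ _ _ _ _) _.
  apply: (@le_trans _ _ (\sum_(0 <= n < N.+1) A * D * r ^+ n)).
    apply: ler_sum => n _; rewrite !cabsM cabsX mulrAC ler_wpM2r ?exprn_ge0 //.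
    by apply: ler_pM; rewrite ?cabs_ge0 //; case: (HD (N.+1 + n)%N).
  by rewrite -big_distrr /= ler_wpM2l ?mulr_ge0 // sum_geo_le.
have HT : cabs (S - deltaq _ q f N.+1 * T) <=
    E / (1 - cabs a) * (D / (1 - r)) * r ^+ N.
  rewrite [S - _](_ : _ = \sum_(0 <= m < N.+1) a ^+ m / (1 + f * q ^+ m) *
      (deltaq _ q f (N.+1 + m) - deltaq _ q f N.+1)); last first.
    rewrite /S /T big_distrr -sumrB; apply: eq_bigr => m _.
    by rewrite [(m + _)%N]addnC /=; ring.
  apply: le_trans (ler_cabs_sum _ _ _ _ _) _.
  apply: (@le_trans _ _ (\sum_(0 <= m < N.+1)
      E * (D / (1 - r)) * r ^+ N * cabs a ^+ m)); last first.
    rewrite -big_distrr /= [leRHS](_ : _ = E * (D / (1 - r)) * r ^+ N / (1 - cabs a)).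
      by rewrite ler_wpM2l ?sum_geo_le // !mulr_ge0 ?exprn_ge0 // invr_ge0 ltW.
    by ring.
  apply: ler_sum => m _; rewrite cabsM [cabs (a ^+ m / _)]cabsM cabsX.
  rewrite [leRHS](_ : _ = cabs a ^+ m * E * (D * r ^+ N / (1 - r))); last by ring.
  apply: ler_pM; rewrite ?mulr_ge0 ?exprn_ge0 ?cabs_ge0 //.
    by rewrite ler_wpM2l ?exprn_ge0.
  apply: le_trans (incr_dist_le _ _ D r r01 _ _ _) _; first by move=> n; case: (HD n).
  by rewrite ler_wpM2r ?invr_ge0 ?(ltW r1) // ler_wpM2l // expr_succ_le.
apply: le_trans (ler_cabsD _ _ _) _; apply: lerD.
  rewrite cabsM [cabs (a ^+ _ * _)]cabsM cabsX exprS /K1.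
  rewrite [leRHS](_ : _ =
    cabs 2 * (cabs a * cabs a ^+ N * (A * D / (1 - r)))); last by ring.
  by rewrite !ler_wpM2l ?mulr_ge0 ?exprn_ge0 ?cabs_ge0.
rewrite cabsM [cabs (_ * betaq _ _ _ _)]cabsM /K2 -[leRHS]mulrA.
apply: ler_pM; rewrite ?mulr_ge0 ?cabs_ge0 // ler_wpM2l ?cabs_ge0 //.
Qed.

End Identity.

(** * Continuity and the zeros of the denominators *)

Lemma cvg_horner (C : numClosedFieldType) (p : {poly C}) (q : C) :
  p.[z] @[z --> q] --> p.[q].
Proof.
elim/poly_ind: p => [|p c IHp].
  have -> : horner (0 : {poly C}) = fun=> 0 by apply/funext => z; rewrite horner0.
  exact: (@cvg_cst C 0 C (nbhs q) (nbhs_filter q)).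
have -> : horner (p * 'X + c%:P) = fun z => p.[z] * z + c.
  by apply/funext => z; rewrite !hornerE.
apply: (@cvgD C C C (nbhs q) (nbhs_filter q)).
  exact: (@cvgM C C (nbhs q) (nbhs_filter q) _ _ _ _ IHp cvg_id).
exact: (@cvg_cst C c C (nbhs q) (nbhs_filter q)).
Qed.

(** Write p = p1 (X - q)^m with p1(q) nonzero: p1 stays nonzero near [q] by continuity, and the
    power vanishes at most at [q]. *)
Lemma near_horner_neq0 (C : numClosedFieldType) (p : {poly C}) (q : C) :
  p != 0 -> \forall z \near q^', p.[z] != 0.
Proof.
move=> p0; have [m [p1]] := multiplicity_XsubC p q; rewrite p0 /= => p1q ->.
have p1z : \forall z \near q^', p1.[z] != 0.
  apply: nbhs_dnbhs.
  have /cvgrPdist_lt := cvg_horner _ p1 q.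
  move=> /(_ `|p1.[q]|); rewrite normr_gt0 => /(_ p1q).
  apply: filterS => z; apply: contraTneq => ->.
  by rewrite subr0 ltxx.
near=> z; rewrite hornerM horner_exp hornerXsubC mulf_neq0 //.
  by near: z.
rewrite expf_neq0 // subr_eq0.
near: z; exact: nbhs_dnbhs_neq.
Unshelve. all: by end_near.
Qed.

(** * Convergence in the unit disc, continuity, and the exceptional points *)

Section Disc.
Variable R : realType.
Implicit Types q z : Cplx R.

Lemma cplx_lim (u : nat -> Cplx R) (l : Cplx R) : u @ \oo --> l -> limn u = l.
Proof. by move=> ul; apply: cvg_lim => //; exact: norm_hausdorff. Qed.

(** [K] and [s] are chosen before [z], which makes the convergence uniform on the closed disc of
    radius [rho]. *)
Lemma pa_psum_incr (rho : R) : 0 <= rho < 1 ->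
  exists K s, 0 <= s < 1 /\ forall z, cabs z <= rho -> forall n,
    cabs (psum (pa_term z) n.+1 - psum (pa_term z) n) <= K * s ^+ n.
Proof.
move=> rho01; have [K [s [K0 s01 HK]]] := pa_geo_decay _ _ rho01.
exists K, s; split => // z zr n; have [s0 s1] := andP s01.
rewrite psumS addrAC subrr add0r /pa_term cabsM cabs_nat cabsX.
apply: (@le_trans _ _ (K * s ^+ n.+1)).
  apply: le_trans (HK _); rewrite ler_wpM2l //.
  by rewrite lerXn2r ?nnegrE ?cabs_ge0 //; case/andP: rho01.
by rewrite ler_wpM2l // exprS ler_piMl ?exprn_ge0 // ltW.
Qed.

Lemma cvg_pa_gf q : cabs q < 1 -> cvgn (psum (pa_term q)).
Proof.
move=> q1; have [|K [s [s01 HK]]] := pa_psum_incr (cabs q); first by rewrite cabs_ge0.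
by apply: (@cplx_geo_cvg _ _ K s) => //; exact: HK.
Qed.

Lemma cvg_prod_factor q : cabs q < 1 -> cvgn (pprod (prod_factor q)).
Proof.
move=> q1; have [M M0 HM] := prod_factor_bounded _ _ q1.
apply: (@cplx_geo_cvg _ _ M (cabs q)); first by rewrite cabs_ge0.
by move=> n; case: (HM n).
Qed.

(** Adds the index 0, needed when iterating the contiguous relation; there the denominator is 1 + f
    > 0. *)
Lemma golden_denom_neq0 q : (forall n, (1 <= n)%N -> sum_denom q n != 0) ->
  forall n, 1 + golden (Cplx R) * q ^+ n != 0.
Proof.
move=> dq [|n]; last exact: (dq n.+1).
by rewrite expr0 mulr1 gt_eqF // addr_gt0 // golden_gt0.
Qed.

Lemma cvg_sum_term q : cabs q < 1 ->
  (forall n, (1 <= n)%N -> sum_denom q n != 0) -> cvgn (psum (sum_term q)).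
Proof.
move=> q1 dq.
have [E E0 HE] := golden_denom_bounded _ _ q1 (golden_denom_neq0 _ dq).
have a1 := cabs_golden_inv R.
apply: (@cplx_geo_cvg _ _ E (cabs (golden_inv (Cplx R)))); first by rewrite cabs_ge0.
move=> n; rewrite psumS addrAC subrr add0r /sum_term cabsM mulrC.
apply: ler_pM; rewrite ?cabs_ge0 //; first exact: (HE n.+1).
rewrite -/(golden_inv (Cplx R)) cabsX exprS ler_piMl ?exprn_ge0 ?cabs_ge0 //.
exact: ltW.
Qed.

Lemma pa_gf_rhs q : cabs q < 1 ->
  (forall n, (1 <= n)%N -> sum_denom q n != 0) -> pa_gf q = rhs q.
Proof.
move=> q1 dq; apply: cplx_lim.
have PE := cvg_prod_factor _ q1; have SE := cvg_sum_term _ q1 dq.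
have HE := heine_limit _ _ q1 (golden_denom_neq0 _ dq).
have [K [s [K0 s01 HK]]] := psum_pa_approx _ _ q1.
have DE : (fun N => psum (pa_term q) N - psum (pa_parts_gf _ q) N) @ \oo --> (0 : Cplx R).
  apply: (@cplx_cvg_squeeze _ _ (fun N => K * s ^+ N)); last exact: cvg_geo.
  by move=> N; rewrite sub0r opprB.
rewrite /rhs; set P := limn (pprod _); set S := limn (psum _).
set a := golden_inv (Cplx R); set f := golden (Cplx R).
have af : a * f = 1 := golden_invM _.
have fa : f = 1 + a := goldenE _.
have f1 : 1 + f != 0 by have := golden_denom_neq0 _ dq 0; rewrite expr0 mulr1.
(* The constants are a^2 and f^2, and a^2 = 1/(1 + f): the closed form becomes the product times the
   sum started at index 0, whose first term is 1/(1 + f). The zeros stand for the limits of the two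
   error terms. *)
have -> : (3 - sqrt5 (Cplx R)) / 2 * P * (1 + (3 + sqrt5 (Cplx R)) / 2 * S) - 2 =
    0 + (0 + P * ((1 + f)^-1 + S) - 2).
  rewrite golden_inv_sqr golden_sqr -/a -/f.
  have -> : (1 + f)^-1 = a ^+ 2.
    apply: (mulfI f1); rewrite divff // [RHS](_ : _ = a * a + a * (a * f)); last by ring.
    by rewrite af mulr1 -[X in _ + X]mulr1 -mulrDr addrC -fa af.
  rewrite !add0r; congr (_ - 2).
  transitivity (P * (a ^+ 2 + (a * f) ^+ 2 * S)); first by ring.
  by rewrite af expr1n mul1r.
apply: (@cvgn_ext (Cplx R) _ (fun N => (psum (pa_term q) N - psum (pa_parts_gf _ q) N) +
  ((2 + psum (pa_parts_gf _ q) N - pprod (prod_factor q) N *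
     \sum_(0 <= m < N.+1) a ^+ m / (1 + f * q ^+ m)) +
   pprod (prod_factor q) N * ((1 + f)^-1 + psum (sum_term q) N) - 2))).
  move=> N; rewrite big_ltn // expr0 mul1r mulr1.
  rewrite -[\sum_(1 <= m < _) _]/(psum (sum_term q) N); ring.
have cst (c : Cplx R) : (fun=> c) @ \oo --> c by exact: cvg_cst.
apply: (@cvgnD (Cplx R) _ _ _ _ DE); apply: (@cvgnD (Cplx R) _ _ _ _ _ (cst _)).
apply: (@cvgnD (Cplx R) _ _ _ _ HE); apply: (@cvgnM (Cplx R) _ _ _ _ PE).
exact: (@cvgnD (Cplx R) _ _ _ _ (cst _) SE).
Qed.

Lemma near_cabs_lt q (e : R) : 0 < e -> \forall z \near q, cabs (q - z) < e.
Proof.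
by move=> e0; apply: (cplx_cvgP R _ _ (nbhs_filter q) id q).2 => //; exact: cvg_id.
Qed.

(** Continuity by an e/3 argument: the tails are uniformly small for [cabs z <= rho], with [rho]
    midway between [cabs q] and 1, and the partial sum is a polynomial [p]. *)
Lemma near_pa_gf q (e : R) : cabs q < 1 -> 0 < e ->
  \forall z \near q, cabs (pa_gf q - pa_gf z) < e.
Proof.
move=> q1 e0; pose rho := (1 + cabs q) / 2.
have q0 := cabs_ge0 _ q.
have rho01 : 0 <= rho < 1 by rewrite /rho; lra.
have [K [s [s01 HK]]] := pa_psum_incr rho rho01.
have tail z N : cabs z <= rho ->
    cabs (pa_gf z - psum (pa_term z) N) <= K / (1 - s) * s ^+ N.
  move=> zr; have z1 : cabs z < 1 by apply: le_lt_trans zr _; case/andP: rho01.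
  apply: (cabs_cvg_le _ _ _ _ _ (cvg_pa_gf _ z1)).
  exists N => // m /= Nm; rewrite mulrAC -(subnKC Nm).
  by apply: incr_dist_le => //; exact: HK.
have e3 : 0 < e / 3 by lra.
have := cvg_geo _ (K / (1 - s)) s s01.
move=> /cvgrPdist_lt /(_ _ e3)[N _ /(_ N (leqnn _)) /=]; rewrite sub0r normrN => HN.
pose p : {poly Cplx R} := \sum_(1 <= n < N.+1) (pa n)%:R *: 'X^n.
have pE z : psum (pa_term z) N = p.[z].
  rewrite /p horner_sum; apply: eq_bigr => n _.
  by rewrite hornerZ hornerXn.
have rq : 0 < rho - cabs q by rewrite /rho; lra.
have /cplx_cvgP /(_ _ e3) pq := cvg_horner _ p q.
near=> z.
have zr : cabs z <= rho.
  have := ler_cabs_sub _ z q; rewrite cabsB.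
  have : cabs (q - z) < rho - cabs q by near: z; exact: near_cabs_lt.
  lra.
have qr : cabs q <= rho by lra.
move: (tail q N qr) (tail z N zr); rewrite !pE.
have : cabs (p.[q] - p.[z]) < e / 3 by near: z.
move: (pa_gf q) (pa_gf z) p.[q] p.[z] => A B C D t1 t2 t3.
have -> : A - B = (A - C) + ((C - D) - (B - D)) by ring.
have := ler_cabsD _ (A - C) ((C - D) - (B - D)).
have := ler_cabsD _ (C - D) (- (B - D)); rewrite cabsN.
have := ler_norm (K / (1 - s) * s ^+ N); lra.
Unshelve. all: by end_near.
Qed.

(** Only finitely many denominators can vanish for [cabs z <= rho], because |f| rho^n < 1 from some
    [N] on; the others are polynomials equal to 1 at 0, whose zeros are isolated. *)
Lemma near_sum_denom_neq0 q : cabs q < 1 ->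
  \forall z \near q^', cabs z < 1 /\ forall n, (1 <= n)%N -> sum_denom z n != 0.
Proof.
move=> q1; pose rho := (1 + cabs q) / 2; pose f := golden (Cplx R).
have q0 := cabs_ge0 _ q.
have rho01 : 0 <= rho < 1 by rewrite /rho; lra.
have rq : 0 < rho - cabs q by rewrite /rho; lra.
have := cvg_geo _ (cabs f) rho rho01.
move=> /cvgrPdist_lt /(_ _ ltr01)[N _ HN].
have small : \forall z \near q^', forall n : 'I_N, (1 <= n)%N -> sum_denom z n != 0.
  apply: filter_forall => n; case: (posnP n) => [->|n0].
    by near=> z.
  have p0 : 1 + f *: 'X^n != 0 :> {poly Cplx R}.
    apply/eqP => /(congr1 (horner^~ 0)); rewrite !hornerE /= expr0n.
    by rewrite gtn_eqF // mulr0 addr0 => /eqP; rewrite oner_eq0.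
  apply: filterS (near_horner_neq0 _ _ q p0) => z + _.
  by rewrite !hornerE.
near=> z.
have zr : cabs z <= rho.
  have := ler_cabs_sub _ z q; rewrite cabsB.
  have : cabs (q - z) < rho - cabs q.
    by near: z; apply: nbhs_dnbhs; exact: near_cabs_lt.
  lra.
split; first by apply: le_lt_trans zr _; case/andP: rho01.
move=> n n1; have [nN|Nn] := ltnP n N.
  suff /(_ (Ordinal nN) n1) :
    forall n : 'I_N, (1 <= n)%N -> sum_denom z n != 0 by [].
  by near: z.
rewrite /sum_denom -/(golden (Cplx R)) -/f -[f * _]opprK; apply: one_sub_neq0.
rewrite cabsN cabsM cabsX; have := HN n Nn; rewrite /= sub0r normrN.
apply: le_lt_trans; apply: le_trans (ler_norm _); rewrite ler_wpM2l ?cabs_ge0 //.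
by rewrite lerXn2r ?nnegrE ?cabs_ge0 //; case/andP: rho01.
Unshelve. all: by end_near.
Qed.

End Disc.

Theorem theorem4p1 (R : realType) (q : Cplx R) (hq : `|q| < 1) :
  [/\ cvgn (psum (pa_term q)),
      cvgn (pprod (prod_factor q)),
      (forall n : nat, (1 <= n)%N -> sum_denom q n != 0) ->
        cvgn (psum (sum_term q)) /\ pa_gf q = rhs q
    & (exists2 n : nat, (1 <= n)%N & sum_denom q n = 0) ->
        rhs z @[z --> q^'] --> pa_gf q].
Proof.
have q1 : cabs q < 1 by rewrite -normr_lt_cabs.
split.
- exact: cvg_pa_gf.
- exact: cvg_prod_factor.
- by move=> dq; split; [exact: cvg_sum_term|exact: pa_gf_rhs].
(* On a punctured neighbourhood of [q] no denominator vanishes, so [rhs] coincides there with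
   [pa_gf], which is continuous at [q]. *)
move=> _; apply/cplx_cvgP => e e0.
apply: filterS2 (near_sum_denom_neq0 _ _ q1) (nbhs_dnbhs (near_pa_gf _ _ _ q1 e0)).
by move=> z [z1 dz]; rewrite -(pa_gf_rhs _ _ z1 dz).
Qed.
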